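(* Let $q$ be a complex number with $0<|q|<1$, let $m$ be a nonnegative integer, and let $\alpha,a,b,z,b_1,\dots,b_m,c_1,\dots,c_m$ be complex numbers with $a,b\neq 0$, $\alpha\ne 1$ and $$\max\{|\alpha abz/q|,\ |\alpha a|,\ |\alpha b|,\ |\alpha c_1|,\dots,|\alpha c_m|\}<1 .$$ Then $$\frac{(\alpha q,\alpha ab/q;q)_\infty}{(\alpha a,\alpha b;q)_\infty}\;{}_{m+2}\phi_{m+1}\left(\begin{matrix}q/a,\,q/b,\,\alpha b_1,\dots,\alpha b_m\\ 0,\,\alpha c_1,\dots,\alpha c_m\end{matrix};q,\ \alpha abz/q\right)$$ $$=\sum_{n=0}^\infty\frac{(1-\alpha q^{2n})(\alpha,q/a,q/b;q)_n\,(-\alpha ab/q)^n q^{n(n-1)/2}}{(1-\alpha)(q,\alpha a,\alpha b;q)_n}\;{}_{m+2}\phi_{m+1}\left(\begin{matrix}q^{-n},\,\alpha q^n,\,\alpha b_1,\dots,\alpha b_m\\ 0,\,\alpha c_1,\dots,\alpha c_m\end{matrix};q,\ zq\right).$$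
   Context: Notation: $(x;q)_0=1$, $(x;q)_n=\prod_{k=0}^{n-1}(1-xq^k)$, $(x;q)_\infty=\prod_{k=0}^\infty(1-xq^k)$, and $(x_1,\dots,x_k;q)_n=(x_1;q)_n\cdots(x_k;q)_n$ (also for $n=\infty$). The basic hypergeometric series is $${}_{r+1}\phi_{r}\left(\begin{matrix}A_1,\dots,A_{r+1}\\ B_1,\dots,B_r\end{matrix};q,z\right)=\sum_{n=0}^\infty\frac{(A_1,\dots,A_{r+1};q)_n}{(q,B_1,\dots,B_r;q)_n}z^n .$$ The series on the right-hand side of the claim terminate because of the factor $(q^{-n};q)_k$. *)

(* Defs.v *)
From Stdlib Require Export Reals.
From Stdlib Require Import Lra.
From Stdlib Require Vector.
From Coquelicot Require Export Coquelicot.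
Export Vector.VectorNotations.

Open Scope C_scope.

(* [CLim] and [CSeries] are total operators, meaningful only when the limit,
   resp. the sum, exists. *)
Definition is_CLim (u : nat -> C) (l : C) : Prop :=
  filterlim u eventually (@locally C_UniformSpace l).

Definition CLim (u : nat -> C) : C :=
  @iota (CompleteNormedModule.CompleteSpace _ C_CompleteNormedModule)
    (is_CLim u).

Definition is_CSeries (t : nat -> C) (s : C) : Prop :=
  @is_series C_AbsRing C_NormedModule t s.

Definition ex_CSeries (t : nat -> C) : Prop := exists s : C, is_CSeries t s.

Definition CSeries (t : nat -> C) : C :=
  @iota (CompleteNormedModule.CompleteSpace _ C_CompleteNormedModule)
    (is_CSeries t).

(* (x;q)_n *)
Fixpoint qpoch (x q : C) (n : nat) : C :=
  match n with
  | O => 1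
  | S k => qpoch x q k * (1 - x * q ^ k)
  end.

(* (x;q)_oo *)
Definition qpoch_inf (x q : C) : C := CLim (qpoch x q).

(* (x_1,...,x_k;q)_n *)
Definition qpochs {k : nat} (xs : Vector.t C k) (q : C) (n : nat) : C :=
  Vector.fold_right (fun x p => qpoch x q n * p) xs 1.

(* (x_1,...,x_k;q)_oo *)
Definition qpochs_inf {k : nat} (xs : Vector.t C k) (q : C) : C :=
  Vector.fold_right (fun x p => qpoch_inf x q * p) xs 1.

Definition phi_term {r : nat} (A : Vector.t C (S r)) (B : Vector.t C r)
    (q z : C) (n : nat) : C :=
  qpochs A q n / qpochs (q :: B)%vector q n * z ^ n.

(* The basic hypergeometric series with r+1 upper and r lower parameters. *)
Definition phi {r : nat} (A : Vector.t C (S r)) (B : Vector.t C r)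
    (q z : C) : C :=
  CSeries (phi_term A B q z).

Lemma CLim_unique (u : nat -> C) (l : C) : is_CLim u l -> CLim u = l.
Proof.
intros H.
exact (@iota_filterlim_locally _ C_CompleteNormedModule _ eventually _ u l H).
Qed.

Lemma CSeries_unique (t : nat -> C) (s : C) : is_CSeries t s -> CSeries t = s.
Proof.
intros H.
exact (@iota_filterlim_locally _ C_CompleteNormedModule _ eventually _
         (sum_n (G := NormedModule.AbelianMonoid _ C_NormedModule) t) s H).
Qed.

Lemma qpoch_bound (x q : C) (n : nat) : (Cmod q < 1)%R ->
  (Cmod (qpoch x q n) <= exp (Cmod x * / (1 - Cmod q) * (1 - Cmod q ^ n)))%R.
Proof.
intros Hq; induction n as [|n IH].
- simpl; rewrite Cmod_1.
  replace (_ * (1 - 1))%R with 0%R by ring.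
  rewrite exp_0; apply Rle_refl.
- simpl qpoch; rewrite Cmod_mult.
  set (e := (Cmod x * Cmod q ^ n)%R).
  replace (Cmod x * / (1 - Cmod q) * (1 - Cmod q ^ S n))%R
    with (Cmod x * / (1 - Cmod q) * (1 - Cmod q ^ n) + e)%R
    by (unfold e; simpl; field; lra).
  rewrite exp_plus.
  assert (He : (Cmod (1 - x * q ^ n) <= exp e)%R).
  { apply Rle_trans with (1 + e)%R; [| apply exp_ineq1_le].
    unfold Cminus; eapply Rle_trans; [apply Cmod_triangle|].
    rewrite Cmod_1, Cmod_opp, Cmod_mult, Cmod_pow; apply Rle_refl. }
  apply Rmult_le_compat; auto using Cmod_ge_0.
Qed.

Local Lemma exp_le_mono (u v : R) : (u <= v)%R -> (exp u <= exp v)%R.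
Proof.
intros [H| ->]; [left; apply exp_increasing, H|apply Rle_refl].
Qed.

Lemma qpoch_inf_correct (x q : C) : (Cmod q < 1)%R ->
  is_CLim (qpoch x q) (qpoch_inf x q).
Proof.
intros Hq.
set (M := exp (Cmod x * / (1 - Cmod q))%R).
assert (Hr : (0 < / (1 - Cmod q))%R) by (apply Rinv_0_lt_compat; lra).
assert (HM : forall n, (Cmod (qpoch x q n) <= M)%R).
{ intros n; eapply Rle_trans; [apply (qpoch_bound x q n Hq)|].
  apply exp_le_mono.
  assert (H1 := pow_le (Cmod q) n (Cmod_ge_0 q)).
  assert (H2 := Rmult_le_pos _ _ (Cmod_ge_0 x) (Rlt_le _ _ Hr)).
  nra. }
set (d := fun n => qpoch x q (S n) - qpoch x q n).
assert (Hd : @ex_series C_AbsRing C_NormedModule d).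
{ apply (@ex_series_le C_AbsRing C_CompleteNormedModule d
           (fun n => (M * Cmod x * Cmod q ^ n)%R)).
  - intros n; change (Cmod (d n) <= M * Cmod x * Cmod q ^ n)%R.
    replace (d n) with (- (qpoch x q n * (x * q ^ n)))
      by (unfold d; simpl; ring).
    rewrite Cmod_opp, 2!Cmod_mult, Cmod_pow, Rmult_assoc.
    apply Rmult_le_compat_r; [|apply HM].
    apply Rmult_le_pos; [|apply pow_le]; apply Cmod_ge_0.
  - apply (ex_series_scal (V := R_NormedModule) (M * Cmod x)%R), ex_series_geom.
    rewrite Rabs_pos_eq; auto using Cmod_ge_0. }
destruct Hd as [s Hs].
assert (Hl : is_CLim (qpoch x q) (s + 1)).
{ intros P HP.
  assert (HP' : locally (T := C_UniformSpace) s (fun y => P (y + 1))).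
  { assert (HF := filterlim_comp_2
              (F := locally (T := C_UniformSpace) s) (fun y : C => y)
              (fun _ : C => RtoC 1) Cplus (filterlim_id _ _)
              (filterlim_const (RtoC 1 : C_UniformSpace))
              (filterlim_plus (V := C_NormedModule) s (RtoC 1))).
    exact (HF P HP). }
  destruct (Hs _ HP') as [N HN].
  exists (S N); intros [|n] Hn; [inversion Hn|].
  assert (E : forall k, sum_n (G := NormedModule.AbelianMonoid _ C_NormedModule)
                          d k = qpoch x q (S k) - 1).
  { induction k as [|k IH].
    - rewrite sum_O; unfold d; simpl; ring.
    - rewrite sum_Sn, IH; change (qpoch x q (S k) - 1 + d (S k)
        = qpoch x q (S (S k)) - 1); unfold d; ring. }
  assert (Hn' := HN n (le_S_n _ _ Hn)); rewrite E in Hn'.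
  replace (qpoch x q (S n)) with (qpoch x q (S n) - 1 + 1) by ring.
  exact Hn'. }
unfold qpoch_inf; rewrite (CLim_unique _ _ Hl); exact Hl.
Qed.

(* Main.v *)
Require Import Defs.
From Stdlib Require Import Lra Lia.

(* Expand the inner terminating series on the right-hand side and put
   [n = k + j]. The powers of [q] combine so that the resulting double series is
   dominated by [|alpha a b z / q|^k |alpha a b / q|^j |q|^(j(j-1)/2)], hence
   the order of summation can be exchanged. For fixed [k] the sum over [j] is a
   very-well-poised series with parameters [alpha q^(2k)], [a / q^k], [b / q^k];
   it has a closed product form, and the products for different [k] differ
   exactly by the factors that turn the sum over [k] into the left-hand side.

   The very-well-poised sum [S(alpha)] is evaluated through the recurrence
     [(1 - alpha a)(1 - alpha b) S(alpha)
      = (1 - alpha q)(1 - alpha a b / q) S(alpha q)],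
   which telescopes termwise (a Wilf-Zeilberger pair), together with
   [S(alpha q^N) -> 1]. Both limit interchanges are instances of Tannery's
   theorem, [is_CLim_series_dominated]. *)

(** * Limits and series of complex numbers *)

Notation Csum := (@sum_n (NormedModule.AbelianMonoid _ C_NormedModule)).

(** The balls of the uniform structure and those of the modulus generate the same neighbourhoods.
    This reduces complex limits to real null sequences. *)
Lemma is_CLim_Cmod (u : nat -> C) (l : C) :
  is_CLim u l <-> is_lim_seq (fun n => Cmod (u n - l)) 0%R.
Proof.
unfold is_CLim; split; intros H.
- apply is_lim_seq_spec; intros eps.
  assert (Hb := H _ (locally_le_locally_norm (K := C_AbsRing)
    (V := C_NormedModule) l _ (locally_norm_ball_norm (K := C_AbsRing)
    (V := C_NormedModule) l eps))).
  destruct Hb as [N HN]; exists N; intros n Hn; specialize (HN n Hn).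
  rewrite Rminus_0_r, Rabs_pos_eq by apply Cmod_ge_0.
  exact HN.
- intros P HP.
  destruct (locally_norm_le_locally (K := C_AbsRing) (V := C_NormedModule)
              l P HP) as [eps Heps].
  apply is_lim_seq_spec in H; specialize (H eps).
  destruct H as [N HN]; exists N; intros n Hn; specialize (HN n Hn).
  apply Heps.
  rewrite Rminus_0_r, Rabs_pos_eq in HN by apply Cmod_ge_0.
  exact HN.
Qed.

Lemma is_CLim_squeeze (u : nat -> C) (l : C) (v : nat -> R) :
  (forall n, (Cmod (u n - l) <= v n)%R) -> is_lim_seq v 0%R -> is_CLim u l.
Proof.
intros Huv Hv; apply is_CLim_Cmod.
apply is_lim_seq_le_le with (fun _ => 0%R) v; auto.
- intros n; split; [apply Cmod_ge_0|apply Huv].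
- apply is_lim_seq_const.
Qed.

Lemma is_CLim_unique (u : nat -> C) (l l' : C) :
  is_CLim u l -> is_CLim u l' -> l = l'.
Proof. intros H H'; now rewrite <- (CLim_unique _ _ H), (CLim_unique _ _ H'). Qed.

Lemma is_CLim_ext (u v : nat -> C) (l : C) :
  (forall n, u n = v n) -> is_CLim u l -> is_CLim v l.
Proof. intros E; apply filterlim_ext, E. Qed.

Lemma is_CLim_const (l : C) : is_CLim (fun _ => l) l.
Proof. apply filterlim_const. Qed.

Lemma is_CLim_Cmod_lim (u : nat -> C) (l : C) :
  is_CLim u l -> is_lim_seq (fun n => Cmod (u n)) (Cmod l).
Proof.
intros H; apply is_CLim_Cmod in H.
apply is_lim_seq_le_le with (fun n => (Cmod l - Cmod (u n - l))%R)
  (fun n => (Cmod l + Cmod (u n - l))%R).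
- intros n; split.
  + assert (Ht := Cmod_triangle (u n) (l - u n)).
    replace (u n + (l - u n)) with l in Ht by ring.
    replace (l - u n) with (- (u n - l)) in Ht by ring.
    rewrite Cmod_opp in Ht; lra.
  + assert (Ht := Cmod_triangle l (u n - l)).
    replace (l + (u n - l)) with (u n) in Ht by ring; lra.
- replace (Finite (Cmod l)) with (Finite (Cmod l - 0)) by (f_equal; ring).
  apply is_lim_seq_minus'; [apply is_lim_seq_const|exact H].
- replace (Finite (Cmod l)) with (Finite (Cmod l + 0)) by (f_equal; ring).
  apply is_lim_seq_plus'; [apply is_lim_seq_const|exact H].
Qed.

Lemma is_CLim_Cmod_le (u : nat -> C) (l : C) (B : R) :
  is_CLim u l -> eventually (fun n => (Cmod (u n) <= B)%R) -> (Cmod l <= B)%R.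
Proof.
intros H HB.
exact (is_lim_seq_le_loc _ (fun _ => B) _ B HB (is_CLim_Cmod_lim _ _ H)
         (is_lim_seq_const B)).
Qed.

Lemma is_CLim_plus (u v : nat -> C) (l m : C) :
  is_CLim u l -> is_CLim v m -> is_CLim (fun n => u n + v n) (l + m).
Proof.
intros Hu Hv; apply is_CLim_Cmod in Hu; apply is_CLim_Cmod in Hv.
apply is_CLim_squeeze with (fun n => (Cmod (u n - l) + Cmod (v n - m))%R).
- intros n; replace (u n + v n - (l + m)) with ((u n - l) + (v n - m)) by ring.
  apply Cmod_triangle.
- replace (Finite 0) with (Finite (0 + 0)) by (f_equal; ring).
  now apply is_lim_seq_plus'.
Qed.

Lemma is_CLim_mult (u v : nat -> C) (l m : C) :
  is_CLim u l -> is_CLim v m -> is_CLim (fun n => u n * v n) (l * m).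
Proof.
intros Hu Hv; assert (Hu' := is_CLim_Cmod_lim _ _ Hu).
apply is_CLim_Cmod in Hu; apply is_CLim_Cmod in Hv.
apply is_CLim_squeeze
  with (fun n => (Cmod (u n) * Cmod (v n - m) + Cmod (u n - l) * Cmod m)%R).
- intros n; replace (u n * v n - l * m) with (u n * (v n - m) + (u n - l) * m)
    by ring.
  eapply Rle_trans; [apply Cmod_triangle|]; rewrite 2!Cmod_mult; apply Rle_refl.
- replace (Finite 0) with (Finite (Cmod l * 0 + 0 * Cmod m)) by (f_equal; ring).
  apply is_lim_seq_plus'; apply is_lim_seq_mult'; auto.
  apply is_lim_seq_const.
Qed.

Lemma Csum_O (t : nat -> C) : Csum t 0%nat = t 0%nat.
Proof. exact (sum_O t). Qed.

Lemma Csum_S (t : nat -> C) (n : nat) : Csum t (S n) = Csum t n + t (S n).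
Proof. exact (sum_Sn t n). Qed.

Lemma Csum_ext (s t : nat -> C) (n : nat) :
  (forall k, (k <= n)%nat -> s k = t k) -> Csum s n = Csum t n.
Proof. intros H; exact (sum_n_ext_loc s t n H). Qed.

Lemma Csum_plus (s t : nat -> C) (n : nat) :
  Csum (fun k => s k + t k) n = Csum s n + Csum t n.
Proof. exact (sum_n_plus s t n). Qed.

Lemma Csum_scal (c : C) (t : nat -> C) (n : nat) :
  Csum (fun k => c * t k) n = c * Csum t n.
Proof. exact (sum_n_mult_l (K := C_Ring) c t n). Qed.

Lemma Csum_le (t : nat -> C) (n : nat) :
  (Cmod (Csum t n) <= sum_n (fun k => Cmod (t k)) n)%R.
Proof. exact (norm_sum_n_m (K := C_AbsRing) (V := C_NormedModule) t 0 n). Qed.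

Lemma is_CSeries_scal (c : C) (t : nat -> C) (s : C) :
  is_CSeries t s -> is_CSeries (fun n => c * t n) (c * s).
Proof. exact (@is_series_scal C_AbsRing C_NormedModule c t s). Qed.

Lemma is_CSeries_ext (t u : nat -> C) (s : C) :
  (forall n, t n = u n) -> is_CSeries t s -> is_CSeries u s.
Proof. exact (@is_series_ext C_AbsRing C_NormedModule t u s). Qed.

Lemma ex_CSeries_le (t : nat -> C) (M : nat -> R) :
  (forall n, (Cmod (t n) <= M n)%R) -> ex_series M -> ex_CSeries t.
Proof. exact (@ex_series_le C_AbsRing C_CompleteNormedModule t M). Qed.

Lemma is_CSeries_finite (t : nat -> C) (n : nat) :
  (forall k, (n < k)%nat -> t k = 0) -> is_CSeries t (Csum t n).
Proof.
intros Ht.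
apply (filterlim_ext_loc (fun _ => Csum t n)); [|apply filterlim_const].
exists n; intros k Hk; induction Hk as [|k Hk IH]; [reflexivity|].
rewrite Csum_S, <- IH, (Ht (S k)) by lia; symmetry; apply Cplus_0_r.
Qed.

Lemma sum_n_le_Series (M : nat -> R) (n : nat) :
  (forall k, (0 <= M k)%R) -> ex_series M -> (sum_n M n <= Series M)%R.
Proof.
intros HM [s Hs]; rewrite (is_series_unique _ _ Hs).
apply (is_lim_seq_incr_compare (sum_n M) s Hs).
intros k; rewrite sum_Sn; unfold plus; simpl; specialize (HM (S k)); lra.
Qed.

(** Tannery's theorem. The bound [M] passes to the limit [g], so [g] is summable by completeness;
    the difference of the sums splits into a finite head, which tends to 0 termwise, and a tail
    controlled by [M] uniformly in [N]. *)
Lemma is_CLim_series_dominated (f : nat -> nat -> C) (g s : nat -> C)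
    (M : nat -> R) :
  (forall N k, (Cmod (f N k) <= M k)%R) -> ex_series M ->
  (forall k, is_CLim (fun N => f N k) (g k)) ->
  (forall N, is_CSeries (f N) (s N)) ->
  exists l, is_CSeries g l /\ is_CLim s l.
Proof.
intros HfM HM Hfg Hs.
assert (HgM : forall k, (Cmod (g k) <= M k)%R).
{ intros k; apply (is_CLim_Cmod_le _ _ _ (Hfg k)).
  exists 0%nat; intros N _; apply HfM. }
destruct (ex_CSeries_le g M HgM HM) as [l Hl].
exists l; split; [exact Hl|].
assert (HM0 : forall k, (0 <= M k)%R).
{ intros k; eapply Rle_trans; [apply Cmod_ge_0|apply (HgM k)]. }
set (d := fun N k => Cmod (f N k - g k)).
assert (Hd : forall N k, (d N k <= 2 * M k)%R).
{ intros N k; unfold d, Cminus; eapply Rle_trans; [apply Cmod_triangle|].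
  rewrite Cmod_opp; specialize (HfM N k); specialize (HgM k); lra. }
(* The cut [K] is independent of [N]: beyond it each difference is at most [2 * M k]. *)
assert (Hb : forall K N,
  (Cmod (s N - l) <= sum_n (d N) K + 2 * (Series M - sum_n M K))%R).
{ intros K N.
  apply (is_CLim_Cmod_le (fun n => Csum (f N) n + (-1) * Csum g n)).
  - replace (s N - l) with (s N + (-1) * l) by ring.
    apply is_CLim_plus; [apply Hs|].
    apply is_CLim_mult; [apply is_CLim_const|exact Hl].
  - exists K; intros n Hn.
    rewrite <- Csum_scal, <- Csum_plus.
    eapply Rle_trans; [apply Csum_le|].
    rewrite (sum_n_ext _ (d N)) by (intros k; unfold d; f_equal; ring).
    assert (Hstep : (sum_n (d N) n
              <= sum_n (d N) K + 2 * (sum_n M n - sum_n M K))%R).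
    { induction Hn as [|n Hn IH]; [lra|].
      rewrite 2!sum_Sn; unfold plus; simpl; specialize (Hd N (S n)); lra. }
    assert (H1 := sum_n_le_Series M n HM0 HM); lra. }
apply is_CLim_Cmod, is_lim_seq_spec; intros eps.
(* The tail counts twice, so [eps / 4] for tail and head gives at most [3 * eps / 4] in total. *)
assert (HK : exists K, (Series M - sum_n M K < eps / 4)%R).
{ assert (Hlim : is_lim_seq (sum_n M) (Series M)) by exact (Series_correct _ HM).
  apply is_lim_seq_spec in Hlim.
  destruct (Hlim (mkposreal (eps / 4)%R ltac:(destruct eps; simpl; lra)))
    as [K HK].
  exists K; specialize (HK K (le_n K)); simpl in HK.
  rewrite Rabs_minus_sym in HK.
  eapply Rle_lt_trans; [apply Rle_abs|exact HK]. }
destruct HK as [K HK].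
assert (Hd0 : is_lim_seq (fun N => sum_n (d N) K) 0%R).
{ clear -Hfg; induction K as [|K IH].
  - apply is_lim_seq_ext with (fun N => d N 0%nat);
      [intros N; rewrite sum_O; reflexivity|].
    apply (proj1 (is_CLim_Cmod _ _) (Hfg 0%nat)).
  - apply is_lim_seq_ext with (fun N => (sum_n (d N) K + d N (S K))%R);
      [intros N; rewrite sum_Sn; reflexivity|].
    replace (Finite 0) with (Finite (0 + 0)) by (f_equal; ring).
    apply is_lim_seq_plus'; [exact IH|].
    apply (proj1 (is_CLim_Cmod _ _) (Hfg (S K))). }
apply is_lim_seq_spec in Hd0.
destruct (Hd0 (mkposreal (eps / 4)%R ltac:(destruct eps; simpl; lra)))
  as [N0 HN0].
exists N0; intros N HN; specialize (HN0 N HN); simpl in HN0.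
rewrite Rminus_0_r in *.
rewrite (Rabs_pos_eq (Cmod _)) by apply Cmod_ge_0.
assert (Ha := Rle_abs (sum_n (d N) K)); specialize (Hb K N).
destruct eps as [eps Heps]; simpl in *; lra.
Qed.

(** Enlarging the triangle by one adds one entry to each old row and one new row of length one;
    together these entries form the next antidiagonal. *)
Lemma Csum_triangle (f : nat -> nat -> C) (N : nat) :
  Csum (fun k => Csum (f k) (N - k)%nat) N
  = Csum (fun n => Csum (fun k => f k (n - k)%nat) n) N.
Proof.
induction N as [|N IH]; [rewrite !Csum_O; reflexivity|].
rewrite (Csum_S (fun n => Csum (fun k => f k (n - k)%nat) n)), <- IH.
rewrite 2!Csum_S, Nat.sub_diag, Csum_O, Cplus_assoc; f_equal.
rewrite <- Csum_plus; apply Csum_ext; intros k Hk.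
replace (S N - k)%nat with (S (N - k)) by lia; apply Csum_S.
Qed.

(** The partial sums over antidiagonals are sums over triangles, hence sums of truncated rows. Row
    [k] is dominated by [u k * Series v] whatever the truncation, so Tannery's theorem applies to
    the rows. *)
Lemma is_CSeries_diagonal (f : nat -> nat -> C) (u v : nat -> R) (F : nat -> C) :
  (forall k j, (Cmod (f k j) <= u k * v j)%R) ->
  (forall k, is_CSeries (f k) (F k)) ->
  (forall k, (0 <= u k)%R) -> (forall j, (0 <= v j)%R) ->
  ex_series u -> ex_series v ->
  exists l, is_CSeries F l
         /\ is_CSeries (fun n => Csum (fun k => f k (n - k)%nat) n) l.
Proof.
intros Hf HF Hu0 Hv0 Hu Hv.
(* The test [Nat.leb k N] is essential: for [k > N] truncated subtraction gives [N - k = 0], which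
   would leave the spurious term [f k 0]. *)
destruct (is_CLim_series_dominated
  (fun N k => if Nat.leb k N then Csum (f k) (N - k) else 0) F
  (fun N => Csum (fun n => Csum (fun k => f k (n - k)%nat) n) N)
  (fun k => (u k * Series v)%R)) as [l [Hl Hl']].
- intros N k; destruct (Nat.leb k N).
  + eapply Rle_trans; [apply Csum_le|].
    apply Rle_trans with (sum_n (fun j => (u k * v j)%R) (N - k)).
    * apply sum_n_m_le; intros j; apply Hf.
    * assert (E : sum_n (fun j => (u k * v j)%R) (N - k)
                  = (u k * sum_n v (N - k))%R)
        by exact (sum_n_mult_l (K := R_Ring) (u k) v (N - k)).
      rewrite E.
      apply Rmult_le_compat_l; [apply Hu0|].
      now apply sum_n_le_Series.
  + rewrite Cmod_0; apply Rmult_le_pos; [apply Hu0|].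
    eapply Rle_trans; [apply (Hv0 0%nat)|].
    rewrite <- (sum_O v); now apply sum_n_le_Series.
- now apply ex_series_scal_r.
- intros k.
  apply (filterlim_ext_loc (fun N => Csum (f k) (N - k)%nat)).
  + exists k; intros N HN.
    now rewrite (proj2 (Nat.leb_le k N) HN).
  + apply (filterlim_comp _ _ _ (fun N => (N - k)%nat) (Csum (f k))
             eventually eventually); [|exact (HF k)].
    intros P [N0 HN0]; exists (N0 + k)%nat; intros N HN; apply HN0; lia.
- intros N; rewrite <- Csum_triangle.
  rewrite (Csum_ext _
    (fun k => if Nat.leb k N then Csum (f k) (N - k) else 0)).
  + apply is_CSeries_finite; intros k Hk.
    now rewrite (proj2 (Nat.leb_gt k N) Hk).
  + intros k Hk; now rewrite (proj2 (Nat.leb_le k N) Hk).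
- now exists l.
Qed.

(** * q-Pochhammer symbols *)

Lemma tri_S (n : nat) : (S n * (S n - 1) / 2 = n * (n - 1) / 2 + n)%nat.
Proof.
rewrite <- Nat.div_add by lia; f_equal; destruct n; simpl; lia.
Qed.

Lemma tri_add (k j : nat) :
  ((k + j) * (k + j - 1) / 2
   = k * (k - 1) / 2 + j * (j - 1) / 2 + k * j)%nat.
Proof.
induction j as [|j IH].
- rewrite !Nat.add_0_r, Nat.mul_0_r, Nat.add_0_r; reflexivity.
- rewrite Nat.add_succ_r, 2!tri_S, IH; lia.
Qed.

Lemma qpoch_add (x q : C) (k j : nat) :
  qpoch x q (k + j) = qpoch x q k * qpoch (x * q ^ k) q j.
Proof.
induction j as [|j IH].
- rewrite Nat.add_0_r; simpl; ring.
- rewrite Nat.add_succ_r; simpl; rewrite IH, Cpow_add_r; ring.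
Qed.

Lemma qpoch_S_l (x q : C) (n : nat) :
  qpoch x q (S n) = (1 - x) * qpoch (x * q) q n.
Proof.
change (S n) with (1 + n)%nat; rewrite qpoch_add, Cpow_1_r; simpl; ring.
Qed.

Lemma qpoch_0_l (q : C) (n : nat) : qpoch 0 q n = 1.
Proof. induction n as [|n IH]; simpl; [|rewrite IH]; ring. Qed.

(** * Bounds for q-Pochhammer symbols, uniform in the argument and the index *)

Lemma one_minus_neq_0 (x : C) : (Cmod x < 1)%R -> 1 - x <> 0.
Proof.
intros Hx E.
replace x with (RtoC 1) in Hx by (rewrite <- (Cplus_0_r x), <- E; ring).
rewrite Cmod_1 in Hx; lra.
Qed.

Lemma Cmod_pow_le_1 (q : C) (n : nat) : (Cmod q < 1)%R -> (Cmod (q ^ n) <= 1)%R.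
Proof.
intros Hq; rewrite Cmod_pow, <- (pow1 n).
apply pow_incr; split; [apply Cmod_ge_0|lra].
Qed.

Lemma Cmod_mul_pow_le (x q : C) (n : nat) :
  (Cmod q < 1)%R -> (Cmod (x * q ^ n) <= Cmod x)%R.
Proof.
intros Hq; rewrite Cmod_mult; rewrite <- (Rmult_1_r (Cmod x)) at 2.
apply Rmult_le_compat_l; [apply Cmod_ge_0|now apply Cmod_pow_le_1].
Qed.

Lemma exp_le (u v : R) : (u <= v)%R -> (exp u <= exp v)%R.
Proof. intros [H| ->]; [left; now apply exp_increasing|apply Rle_refl]. Qed.

(** The constant must serve all [x] in a disc at once, because the parameters later move with the
    summation index, as in [alpha * q ^ N]. *)
Lemma qpoch_uniform_bound (q : C) (X : R) : (Cmod q < 1)%R ->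
  exists K, (0 < K)%R /\
    forall x n, (Cmod x <= X)%R -> (Cmod (qpoch x q n) <= K)%R.
Proof.
intros Hq; exists (exp (X * / (1 - Cmod q))); split; [apply exp_pos|].
intros x n Hx; eapply Rle_trans; [apply (qpoch_bound x q n Hq)|].
apply exp_le.
assert (Hr : (0 < / (1 - Cmod q))%R) by (apply Rinv_0_lt_compat; lra).
assert (H1 := pow_le (Cmod q) n (Cmod_ge_0 q)).
assert (H2 := Rmult_le_pos _ _ (Cmod_ge_0 x) (Rlt_le _ _ Hr)).
assert (H3 : (Cmod x * / (1 - Cmod q) <= X * / (1 - Cmod q))%R)
  by (apply Rmult_le_compat_r; lra).
nra.
Qed.

(** Each factor has modulus at least [1 - r |q|^i >= exp (- |q|^i / (1 - r))], and the exponents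
    form a convergent geometric series. *)
Lemma qpoch_lower_bound (q : C) (r : R) : (Cmod q < 1)%R -> (r < 1)%R ->
  exists K, (0 < K)%R /\
    forall x n, (Cmod x <= r)%R -> (K <= Cmod (qpoch x q n))%R.
Proof.
intros Hq Hr.
set (s := (/ (1 - r))%R).
assert (Hs : (0 < s)%R) by (apply Rinv_0_lt_compat; lra).
assert (Hq' : (0 < / (1 - Cmod q))%R) by (apply Rinv_0_lt_compat; lra).
exists (exp (- (s * / (1 - Cmod q))))%R; split; [apply exp_pos|].
intros x n Hx.
(* The induction needs the partial geometric sum in the exponent, not its limit. *)
apply Rle_trans with (exp (- (s * / (1 - Cmod q) * (1 - Cmod q ^ n)))).
{ apply exp_le.
  assert (H1 := pow_le (Cmod q) n (Cmod_ge_0 q)).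
  assert (H2 := Rmult_lt_0_compat _ _ Hs Hq'); nra. }
induction n as [|n IH].
- simpl; rewrite Cmod_1.
  replace (- _)%R with 0%R by ring; rewrite exp_0; apply Rle_refl.
- simpl qpoch; rewrite Cmod_mult.
  replace (- (s * / (1 - Cmod q) * (1 - Cmod q ^ S n)))%R
    with (- (s * / (1 - Cmod q) * (1 - Cmod q ^ n)) + - (s * Cmod q ^ n))%R
    by (simpl; field; lra).
  rewrite exp_plus; apply Rmult_le_compat; auto;
    try (apply Rlt_le, exp_pos).
  assert (Hy0 := pow_le (Cmod q) n (Cmod_ge_0 q)).
  assert (Hy1 : (Cmod q ^ n <= 1)%R)
    by (rewrite <- Cmod_pow; now apply Cmod_pow_le_1).
  assert (Ht : (1 - Cmod x * Cmod q ^ n <= Cmod (1 - x * q ^ n))%R).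
  { assert (H := Cmod_triangle (1 - x * q ^ n) (x * q ^ n)).
    replace (1 - x * q ^ n + x * q ^ n) with (RtoC 1) in H by ring.
    rewrite Cmod_1, Cmod_mult, Cmod_pow in H; lra. }
  eapply Rle_trans; [|exact Ht].
  set (y := (Cmod q ^ n)%R) in *.
  assert (Hx0 := Cmod_ge_0 x).
  (* [1 / (1 - r y) <= 1 + y / (1 - r) <= exp (y / (1 - r))] *)
  assert (He := exp_ineq1_le (s * y)%R).
  rewrite exp_Ropp.
  apply Rmult_le_reg_l with (exp (s * y)); [apply exp_pos|].
  rewrite Rinv_r by (apply Rgt_not_eq, exp_pos).
  assert (Hsr : (s * (1 - r) = 1)%R) by (unfold s; field; lra).
  assert (Hxy : (Cmod x * y <= r * y)%R) by (apply Rmult_le_compat_r; auto).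
  assert (Hry : (r * y <= r)%R) by nra.
  apply Rle_trans with ((1 + s * y) * (1 - r * y))%R.
  + assert (Hsy : (0 <= s * y)%R) by (apply Rmult_le_pos; lra).
    assert (H : (s * y * (1 - r) <= s * y * (1 - r * y))%R)
      by (apply Rmult_le_compat_l; lra).
    replace (s * y * (1 - r))%R with (s * (1 - r) * y)%R in H by ring.
    rewrite Hsr in H.
    nra.
  + apply Rmult_le_compat; nra.
Qed.

Lemma qpoch_neq_0 (x q : C) (n : nat) :
  (Cmod q < 1)%R -> (Cmod x < 1)%R -> qpoch x q n <> 0.
Proof.
intros Hq Hx E.
destruct (qpoch_lower_bound q (Cmod x) Hq Hx) as [K [HK H]].
specialize (H x n (Rle_refl _)); rewrite E, Cmod_0 in H; lra.
Qed.

Lemma qpoch_inf_neq_0 (x q : C) :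
  (Cmod q < 1)%R -> (Cmod x < 1)%R -> qpoch_inf x q <> 0.
Proof.
intros Hq Hx E.
destruct (qpoch_lower_bound q (Cmod x) Hq Hx) as [K [HK H]].
assert (Hl := is_CLim_Cmod_lim _ _ (qpoch_inf_correct x q Hq)).
assert (Hle := is_lim_seq_le _ _ _ _ (fun n => H x n (Rle_refl _))
                 (is_lim_seq_const K) Hl).
simpl in Hle; rewrite E, Cmod_0 in Hle; lra.
Qed.

Lemma qpoch_inv_bound (q : C) (r : R) : (Cmod q < 1)%R -> (r < 1)%R ->
  exists K, (0 < K)%R /\
    forall x n, (Cmod x <= r)%R -> (Cmod (/ qpoch x q n) <= K)%R.
Proof.
intros Hq Hr; destruct (qpoch_lower_bound q r Hq Hr) as [K [HK H]].
exists (/ K)%R; split; [now apply Rinv_0_lt_compat|].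
intros x n Hx; rewrite Cmod_inv by (apply qpoch_neq_0; lra).
apply Rinv_le_contravar; auto.
Qed.

Lemma ex_series_theta (c r : R) : (0 <= c)%R -> (0 < r < 1)%R ->
  ex_series (fun j => (c ^ j * r ^ (j * (j - 1) / 2))%R).
Proof.
intros Hc Hr.
(* The ratio test requires nonzero terms, while [c] vanishes when [alpha = 0]; hence the comparison
   with [c + 1], for which the ratio is [(c + 1) * r ^ j]. *)
apply (@ex_series_le R_AbsRing R_CompleteNormedModule _
         (fun j => Rabs ((c + 1) ^ j * r ^ (j * (j - 1) / 2))%R)).
- intros j; unfold norm; simpl; unfold abs; simpl.
  rewrite 2!Rabs_mult; apply Rmult_le_compat_r; [apply Rabs_pos|].
  rewrite 2!Rabs_pos_eq by (apply pow_le; lra).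
  apply pow_incr; lra.
- apply ex_series_DAlembert with 0%R; [lra| |].
  + intros j; apply Rmult_integral_contrapositive_currified;
      apply pow_nonzero; lra.
  + apply is_lim_seq_ext with (fun j => ((c + 1) * r ^ j)%R).
    * intros j; rewrite tri_S, pow_add; simpl.
      assert (Hcj := pow_le (c + 1) j); assert (Hrj := pow_le r j).
      replace (_ / _)%R with ((c + 1) * r ^ j)%R
        by (field; split; apply pow_nonzero; lra).
      rewrite Rabs_pos_eq; [reflexivity|].
      apply Rmult_le_pos; [lra|apply Hrj; lra].
    * replace (Finite 0) with (Finite ((c + 1) * 0)) by (f_equal; ring).
      apply is_lim_seq_mult'; [apply is_lim_seq_const|].
      apply is_lim_seq_geom; rewrite Rabs_pos_eq; lra.
Qed.

(* [vwp alpha q n] is [(1 - alpha q^(2n)) (alpha;q)_n / (1 - alpha)], in a form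
   that also makes sense at [alpha = 1]: the summation formula is applied to
   [alpha q^(2k)], which may be [1]. *)
Definition vwp (alpha q : C) (n : nat) : C :=
  match n with
  | O => 1
  | S k => (1 - alpha * q ^ (2 * n)) * qpoch (alpha * q) q k
  end.

Lemma vwp_correct (alpha q : C) (n : nat) :
  (1 - alpha * q ^ (2 * n)) * qpoch alpha q n = (1 - alpha) * vwp alpha q n.
Proof.
destruct n as [|n]; [simpl; ring|].
rewrite qpoch_S_l; unfold vwp; ring.
Qed.

(** Let [n = k + j]. For [j > 0] the consecutive blocks [(alpha q;q)_(n-1)] and [(alpha q^n;q)_k]
    merge into [(alpha q;q)_(2k+j-1)], which is cut again after [2k] factors; the factor
    [1 - alpha q^(2n)] is common to both sides. For [j = 0 < k] that factor is the last one of
    [(alpha q;q)_(2k)]. *)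
Lemma vwp_mul_qpoch (alpha q : C) (k j : nat) :
  vwp alpha q (k + j) * qpoch (alpha * q ^ (k + j)) q k
  = qpoch (alpha * q) q (2 * k) * vwp (alpha * q ^ (2 * k)) q j.
Proof.
destruct j as [|j].
- rewrite Nat.add_0_r; destruct k as [|k]; [simpl; ring|].
  unfold vwp.
  replace (2 * S k)%nat with (S (k + S k)) by lia.
  assert (E := qpoch_add (alpha * q) q k (S k)).
  replace (alpha * q * q ^ k) with (alpha * q ^ S k) in E
    by (rewrite Cpow_S; ring).
  change (qpoch (alpha * q) q (S (k + S k)))
    with (qpoch (alpha * q) q (k + S k) * (1 - alpha * q * q ^ (k + S k))).
  rewrite E, (Cpow_S q (k + S k)); ring.
- rewrite Nat.add_succ_r; unfold vwp.
  assert (E := qpoch_add (alpha * q) q (k + j) k).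
  replace (k + j + k)%nat with (2 * k + j)%nat in E by lia.
  rewrite (qpoch_add _ q (2 * k) j) in E.
  replace (alpha * q * q ^ (k + j)) with (alpha * q ^ S (k + j)) in E
    by (rewrite Cpow_S; ring).
  replace (alpha * q ^ (2 * k) * q) with (alpha * q * q ^ (2 * k)) by ring.
  replace (2 * S (k + j))%nat with (2 * k + 2 * S j)%nat by lia.
  rewrite Cpow_add_r.
  transitivity ((1 - alpha * q ^ (2 * k) * q ^ (2 * S j))
    * (qpoch (alpha * q) q (k + j) * qpoch (alpha * q ^ S (k + j)) q k));
    [|rewrite <- E]; ring.
Qed.

Lemma vwp_uniform_bound (q : C) (A : R) : (Cmod q < 1)%R ->
  exists K, (0 < K)%R /\
    forall alpha n, (Cmod alpha <= A)%R -> (Cmod (vwp alpha q n) <= K)%R.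
Proof.
intros Hq; destruct (qpoch_uniform_bound q A Hq) as [K [HK H]].
(* [A] may be negative; [Rabs A] keeps the constant positive. *)
exists (1 + (1 + Rabs A) * K)%R.
assert (HA := Rabs_pos A).
assert (HAK : (0 <= (1 + Rabs A) * K)%R) by (apply Rmult_le_pos; lra).
split; [lra|]; intros alpha [|n] Ha; unfold vwp; [rewrite Cmod_1; lra|].
rewrite Cmod_mult.
apply Rle_trans with ((1 + Rabs A) * K)%R; [|lra].
apply Rmult_le_compat; try apply Cmod_ge_0.
- unfold Cminus; eapply Rle_trans; [apply Cmod_triangle|].
  rewrite Cmod_1, Cmod_opp; apply Rplus_le_compat_l.
  eapply Rle_trans; [now apply Cmod_mul_pow_le|].
  eapply Rle_trans; [exact Ha|apply Rle_abs].
- apply H; rewrite <- (Cpow_1_r q) at 1.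
  eapply Rle_trans; [now apply Cmod_mul_pow_le|exact Ha].
Qed.

(** * The very-well-poised sum *)

(** The summand of [S(alpha)]: the coefficient of the inner series on the right-hand side, with the
    quotient by [1 - alpha] absorbed into [vwp]. *)
Definition wterm (q alpha a b : C) (n : nat) : C :=
  vwp alpha q n * (qpoch (q / a) q n * qpoch (q / b) q n)
    / (qpoch q q n * (qpoch (alpha * a) q n * qpoch (alpha * b) q n))
    * (- (alpha * a * b / q)) ^ n * q ^ (n * (n - 1) / 2).

(* [wz_cert n] is the Wilf-Zeilberger certificate [G_(n+1)]; [G_0 = 0]. *)
Definition wz_cert (q alpha a b : C) (n : nat) : C :=
  - (qpoch (alpha * q) q n * (qpoch (q / a) q (S n) * qpoch (q / b) q (S n))
    / (qpoch q q n * (qpoch (alpha * a) q (S n) * qpoch (alpha * b) q (S n)))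
    * (- (alpha * a * b / q)) ^ S n * q ^ (S n * (S n - 1) / 2)).

Lemma Cmod_theta (x q : C) (n k : nat) :
  Cmod ((- x) ^ n * q ^ k) = (Cmod x ^ n * Cmod q ^ k)%R.
Proof. now rewrite Cmod_mult, 2!Cmod_pow, Cmod_opp. Qed.

(** Serves both [wterm] and [wz_cert]; the separate index [m] is there because the certificate pairs
    [qpoch q q n] with the other symbols at [S n]. *)
Lemma wfactor_bound (q : C) (X r : R) :
  (Cmod q < 1)%R -> (r < 1)%R ->
  exists K, (0 < K)%R /\ forall a b x y m n,
    (Cmod a <= X)%R -> (Cmod b <= X)%R ->
    (Cmod x <= r)%R -> (Cmod y <= r)%R ->
    (Cmod ((qpoch a q n * qpoch b q n)
             / (qpoch q q m * (qpoch x q n * qpoch y q n))) <= K)%R.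
Proof.
intros Hq Hr.
destruct (qpoch_uniform_bound q X Hq) as [K1 [HK1 H1]].
destruct (qpoch_inv_bound q (Cmod q) Hq Hq) as [K2 [HK2 H2]].
destruct (qpoch_inv_bound q r Hq Hr) as [K3 [HK3 H3]].
exists (K1 * K1 * (K2 * (K3 * K3)))%R; split.
{ repeat apply Rmult_lt_0_compat; assumption. }
intros a b x y m n Ha Hb Hx Hy.
assert (Nq := qpoch_neq_0 q q m Hq Hq).
assert (Nx : qpoch x q n <> 0) by (apply qpoch_neq_0; lra).
assert (Ny : qpoch y q n <> 0) by (apply qpoch_neq_0; lra).
replace ((qpoch a q n * qpoch b q n)
             / (qpoch q q m * (qpoch x q n * qpoch y q n)))
  with (qpoch a q n * qpoch b q n
        * (/ qpoch q q m * (/ qpoch x q n * / qpoch y q n)))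
  by (field; auto).
rewrite !Cmod_mult.
repeat apply Rmult_le_compat; try apply Cmod_ge_0;
  try (repeat apply Rmult_le_pos; apply Cmod_ge_0); auto.
apply H2, Rle_refl.
Qed.

(** The constant is independent of [alpha], [a], [b], so it covers both the shifts [alpha * q ^ N]
    and the triples [alpha * q ^ (2 * k)], [a / q ^ k], [b / q ^ k]. *)
Lemma wterm_bound (q : C) (A X r : R) :
  (Cmod q < 1)%R -> (r < 1)%R ->
  exists K, (0 < K)%R /\ forall alpha a b n,
    (Cmod alpha <= A)%R -> (Cmod (q / a) <= X)%R -> (Cmod (q / b) <= X)%R ->
    (Cmod (alpha * a) <= r)%R -> (Cmod (alpha * b) <= r)%R ->
    (Cmod (wterm q alpha a b n)
     <= K * (Cmod (alpha * a * b / q) ^ n * Cmod q ^ (n * (n - 1) / 2)))%R.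
Proof.
intros Hq Hr.
destruct (wfactor_bound q X r Hq Hr) as [K1 [HK1 H1]].
destruct (vwp_uniform_bound q A Hq) as [K2 [HK2 H2]].
exists (K2 * K1)%R; split; [now apply Rmult_lt_0_compat|].
intros alpha a b n HA Ha Hb Hx Hy.
unfold wterm.
rewrite <- Cmod_theta, <- Cmult_assoc, (Cmod_mult _ (_ * _)).
apply Rmult_le_compat_r; [apply Cmod_ge_0|].
unfold Cdiv at 1; rewrite <- Cmult_assoc, Cmod_mult.
apply Rmult_le_compat; try apply Cmod_ge_0; [now apply H2|].
apply H1; assumption.
Qed.

Lemma wz_cert_lim (q alpha a b : C) :
  (0 < Cmod q)%R -> (Cmod q < 1)%R ->
  (Cmod (alpha * a) < 1)%R -> (Cmod (alpha * b) < 1)%R ->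
  is_CLim (wz_cert q alpha a b) 0.
Proof.
intros Hq0 Hq Ha Hb.
destruct (wfactor_bound q (Rmax (Cmod (q / a)) (Cmod (q / b)))
            (Rmax (Cmod (alpha * a)) (Cmod (alpha * b))) Hq)
  as [K1 [HK1 H1]]; [now apply Rmax_lub_lt|].
destruct (qpoch_uniform_bound q (Cmod (alpha * q)) Hq) as [K2 [HK2 H2]].
set (c := Cmod (alpha * a * b / q)).
apply is_CLim_squeeze with (fun n =>
  (K2 * K1 * (c ^ S n * Cmod q ^ (S n * (S n - 1) / 2)))%R).
- intros n; unfold Cminus; rewrite Copp_0, Cplus_0_r; unfold wz_cert.
  rewrite Cmod_opp; unfold c.
  rewrite <- Cmod_theta, <- Cmult_assoc, (Cmod_mult _ (_ * _)).
  apply Rmult_le_compat_r; [apply Cmod_ge_0|].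
  unfold Cdiv at 1; rewrite <- Cmult_assoc, Cmod_mult.
  apply Rmult_le_compat; try apply Cmod_ge_0; [apply H2, Rle_refl|].
  apply H1; auto using Rmax_l, Rmax_r.
- replace (Finite 0) with (Finite (K2 * K1 * 0)) by (f_equal; ring).
  apply is_lim_seq_mult'; [apply is_lim_seq_const|].
  apply (is_lim_seq_incr_1 (fun n => (c ^ n * Cmod q ^ (n * (n - 1) / 2))%R)).
  apply ex_series_lim_0, ex_series_theta; [apply Cmod_ge_0|lra].
Qed.

Lemma mul_q_pow_neq (x q : C) (n : nat) :
  (Cmod q < 1)%R -> (Cmod x < 1)%R -> 1 - x * q ^ n <> 0.
Proof.
intros Hq Hx; apply one_minus_neq_0.
eapply Rle_lt_trans; [now apply Cmod_mul_pow_le|exact Hx].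
Qed.

Lemma qpoch_shift (x q : C) (n : nat) : 1 - x <> 0 ->
  qpoch (x * q) q n = qpoch x q n * (1 - x * q ^ n) / (1 - x).
Proof.
intros Hx; assert (E := qpoch_S_l x q n); simpl in E.
rewrite E; field; exact Hx.
Qed.

(** Once the shifted symbols are expressed through the unshifted ones, a rational identity in
    [q ^ n] and the parameters remains. *)
Lemma wterm_wz (q alpha a b : C) (n : nat) :
  (0 < Cmod q)%R -> (Cmod q < 1)%R -> a <> 0 -> b <> 0 ->
  (Cmod (alpha * a) < 1)%R -> (Cmod (alpha * b) < 1)%R ->
  (1 - alpha * a) * (1 - alpha * b) * wterm q alpha a b n
  - (1 - alpha * q) * (1 - alpha * a * b / q) * wterm q (alpha * q) a b n
  = (1 - alpha * a) * (1 - alpha * b)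
    * (wz_cert q alpha a b n
       - match n with O => 0 | S k => wz_cert q alpha a b k end).
Proof.
intros Hq0 Hq Ha Hb Hx Hy.
assert (Nq : q <> 0) by now apply Cmod_gt_0.
assert (Nx := one_minus_neq_0 _ Hx); assert (Ny := one_minus_neq_0 _ Hy).
unfold wterm, wz_cert.
rewrite (Cpow_S (- (alpha * a * b / q)) n), tri_S, Cpow_add_r.
destruct n as [|n].
- simpl; field; repeat split; auto.
- replace (alpha * q * a) with (alpha * a * q) by ring.
  replace (alpha * q * b) with (alpha * b * q) by ring.
  rewrite (qpoch_shift (alpha * a)), (qpoch_shift (alpha * b)) by assumption.
  replace (- (alpha * a * q * b / q)) with (- (alpha * a * b / q) * q)
    by (field; auto).
  rewrite Cpow_mult_l.
  assert (E := qpoch_S_l (alpha * q) q n).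
  unfold vwp.
  replace (2 * S n)%nat with (S n + S n)%nat by lia; rewrite Cpow_add_r.
  set (e := (S n * (S n - 1) / 2)%nat) in *.
  set (th := (- (alpha * a * b / q)) ^ S n).
  assert (N1 := qpoch_neq_0 q q n Hq Hq).
  assert (N2 := qpoch_neq_0 (alpha * a) q (S n) Hq Hx).
  assert (N3 := qpoch_neq_0 (alpha * b) q (S n) Hq Hy).
  assert (N4 := mul_q_pow_neq q q n Hq Hq).
  assert (N5 := mul_q_pow_neq (alpha * a) q (S n) Hq Hx).
  assert (N6 := mul_q_pow_neq (alpha * b) q (S n) Hq Hy).
  change (qpoch q q (S n)) with (qpoch q q n * (1 - q * q ^ n)).
  change (qpoch (alpha * a) q (S (S n)))
    with (qpoch (alpha * a) q (S n) * (1 - alpha * a * q ^ S n)).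
  change (qpoch (alpha * b) q (S (S n)))
    with (qpoch (alpha * b) q (S n) * (1 - alpha * b * q ^ S n)).
  change (qpoch (q / a) q (S (S n)))
    with (qpoch (q / a) q (S n) * (1 - q / a * q ^ S n)).
  change (qpoch (q / b) q (S (S n)))
    with (qpoch (q / b) q (S n) * (1 - q / b * q ^ S n)).
  change (qpoch (alpha * q) q (S n))
    with (qpoch (alpha * q) q n * (1 - alpha * q * q ^ n)) in *.
  set (P := qpoch (alpha * q * q) q n) in *.
  set (p := qpoch (alpha * q) q n) in *.
  set (Q := qpoch q q n) in *.
  set (A := qpoch (alpha * a) q (S n)) in *.
  set (B := qpoch (alpha * b) q (S n)) in *.
  set (A' := qpoch (q / a) q (S n)) in *.
  set (B' := qpoch (q / b) q (S n)) in *.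
  rewrite (Cpow_S q n) in *.
  set (x := q ^ n) in *.
  set (qe := q ^ e) in *.
  clearbody P p Q A B A' B' x qe th.
  (* The product [(1 - alpha * q) * P] is isolated so that [E] turns it into
     [p * (1 - alpha * q * x)]. This avoids a division by [1 - alpha * q], which may vanish. *)
  transitivity ((1 - alpha * a) * (1 - alpha * b) *
   ((1 - alpha * (q * x * (q * x))) * p * (A' * B') /
    (Q * (1 - q * x) * (A * B)) * th * qe) -
   (1 - alpha * a * b / q) * ((1 - alpha * q) * P) *
   ((1 - alpha * q * (q * x * (q * x))) * (A' * B') /
    (Q * (1 - q * x) *
     (A * (1 - alpha * a * (q * x)) / (1 - alpha * a) *
      (B * (1 - alpha * b * (q * x)) / (1 - alpha * b)))) *
    (th * (q * x)) * qe)).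
  { unfold Cdiv; ring. }
  rewrite <- E; field; repeat split; auto.
Qed.

Lemma is_CSeries_wterm (q alpha a b : C) :
  (0 < Cmod q)%R -> (Cmod q < 1)%R ->
  (Cmod (alpha * a) < 1)%R -> (Cmod (alpha * b) < 1)%R ->
  is_CSeries (wterm q alpha a b) (CSeries (wterm q alpha a b)).
Proof.
intros Hq0 Hq Hx Hy.
destruct (wterm_bound q (Cmod alpha) (Rmax (Cmod (q / a)) (Cmod (q / b)))
            (Rmax (Cmod (alpha * a)) (Cmod (alpha * b))) Hq)
  as [K [HK H]]; [now apply Rmax_lub_lt|].
destruct (ex_CSeries_le (wterm q alpha a b) _
  (fun n => H alpha a b n (Rle_refl _) (Rmax_l _ _) (Rmax_r _ _)
              (Rmax_l _ _) (Rmax_r _ _))) as [s Hs].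
- apply (ex_series_scal (V := R_NormedModule) K), ex_series_theta;
    [apply Cmod_ge_0|lra].
- now rewrite (CSeries_unique _ _ Hs).
Qed.

Lemma CSeries_wterm_rec (q alpha a b : C) :
  (0 < Cmod q)%R -> (Cmod q < 1)%R -> a <> 0 -> b <> 0 ->
  (Cmod (alpha * a) < 1)%R -> (Cmod (alpha * b) < 1)%R ->
  (1 - alpha * a) * (1 - alpha * b) * CSeries (wterm q alpha a b)
  = (1 - alpha * q) * (1 - alpha * a * b / q)
    * CSeries (wterm q (alpha * q) a b).
Proof.
intros Hq0 Hq Ha Hb Hx Hy.
assert (Hlt : forall c, (Cmod (alpha * c) < 1)%R ->
                (Cmod (alpha * q * c) < 1)%R).
{ intros c Hc; replace (alpha * q * c) with (alpha * c * q ^ 1) by (simpl; ring).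
  eapply Rle_lt_trans; [now apply Cmod_mul_pow_le|exact Hc]. }
assert (H1 := is_CSeries_wterm q alpha a b Hq0 Hq Hx Hy).
assert (H2 := is_CSeries_wterm q (alpha * q) a b Hq0 Hq (Hlt a Hx) (Hlt b Hy)).
set (c1 := (1 - alpha * a) * (1 - alpha * b)).
set (c2 := (1 - alpha * q) * (1 - alpha * a * b / q)).
(* The telescoped form of [wterm_wz]: only the last certificate survives, the one before index 0
   being 0. *)
assert (Hpart : forall n,
  c1 * wz_cert q alpha a b n + c2 * Csum (wterm q (alpha * q) a b) n
  = c1 * Csum (wterm q alpha a b) n).
{ induction n as [|n IH].
  - assert (E := wterm_wz q alpha a b 0 Hq0 Hq Ha Hb Hx Hy).
    cbv iota in E; fold c1 c2 in E; rewrite 2!Csum_O.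
    replace (c1 * wz_cert q alpha a b 0)
      with (c1 * (wz_cert q alpha a b 0 - 0)) by ring.
    rewrite <- E; ring.
  - assert (E := wterm_wz q alpha a b (S n) Hq0 Hq Ha Hb Hx Hy).
    cbv iota in E; fold c1 c2 in E; rewrite 2!Csum_S.
    replace (c1 * wz_cert q alpha a b (S n))
      with (c1 * (wz_cert q alpha a b (S n) - wz_cert q alpha a b n)
            + c1 * wz_cert q alpha a b n) by ring.
    rewrite <- E, Cmult_plus_distr_l, (Cmult_plus_distr_l c1), <- IH; ring. }
(* The right-hand side becomes [c1 * 0 + c2 * S(alpha q)], the limit of the left-hand side of
   [Hpart]. *)
symmetry; rewrite <- (Cplus_0_l (c2 * _)), <- (Cmult_0_r c1).
apply (is_CLim_unique (fun n =>
  c1 * wz_cert q alpha a b n + c2 * Csum (wterm q (alpha * q) a b) n)).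
- apply is_CLim_plus; apply is_CLim_mult; try apply is_CLim_const;
    [now apply wz_cert_lim|exact H2].
- apply (is_CLim_ext (fun n => c1 * Csum (wterm q alpha a b) n)).
  + intros n; now rewrite Hpart.
  + apply is_CLim_mult; [apply is_CLim_const|exact H1].
Qed.

(** The power of [alpha q^N a b / q] gives term [j] a factor [q^(N j)], so only term 0, which is 1,
    survives in the limit. *)
Lemma CSeries_wterm_shift_lim (q alpha a b : C) :
  (0 < Cmod q)%R -> (Cmod q < 1)%R ->
  (Cmod (alpha * a) < 1)%R -> (Cmod (alpha * b) < 1)%R ->
  is_CLim (fun N => CSeries (wterm q (alpha * q ^ N) a b)) 1.
Proof.
intros Hq0 Hq Hx Hy.
assert (Hle : forall N c, (Cmod (alpha * q ^ N * c) <= Cmod (alpha * c))%R).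
{ intros N c; replace (alpha * q ^ N * c) with (alpha * c * q ^ N) by ring.
  now apply Cmod_mul_pow_le. }
destruct (wterm_bound q (Cmod alpha) (Rmax (Cmod (q / a)) (Cmod (q / b)))
            (Rmax (Cmod (alpha * a)) (Cmod (alpha * b))) Hq)
  as [K [HK H]]; [now apply Rmax_lub_lt|].
set (c := Cmod (alpha * a * b / q)).
set (M := fun j => (K * (c ^ j * Cmod q ^ (j * (j - 1) / 2)))%R).
assert (Hc : (0 <= c)%R) by apply Cmod_ge_0.
assert (Hf : forall N j, (Cmod (wterm q (alpha * q ^ N) a b j)
                          <= M j * (Cmod q ^ N) ^ j)%R).
{ intros N j; eapply Rle_trans.
  - apply H; auto using Rmax_l, Rmax_r.
    + now apply Cmod_mul_pow_le.
    + eapply Rle_trans; [apply Hle|apply Rmax_l].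
    + eapply Rle_trans; [apply Hle|apply Rmax_r].
  - replace (alpha * q ^ N * a * b / q) with (alpha * a * b / q * q ^ N)
      by (unfold Cdiv; ring).
    rewrite Cmod_mult, Cmod_pow, Rpow_mult_distr; fold c; unfold M.
    right; ring. }
assert (HM0 : forall j, (0 <= M j)%R).
{ intros j; unfold M; repeat apply Rmult_le_pos; try apply pow_le;
    auto using Cmod_ge_0; lra. }
assert (Hq1 : forall N, (0 <= Cmod q ^ N <= 1)%R).
{ intros N; split; [apply pow_le, Cmod_ge_0|].
  rewrite <- Cmod_pow; now apply Cmod_pow_le_1. }
destruct (is_CLim_series_dominated
  (fun N => wterm q (alpha * q ^ N) a b)
  (fun j => match j with O => 1 | S _ => 0 end)
  (fun N => CSeries (wterm q (alpha * q ^ N) a b)) M) as [l [Hl Hl']].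
- intros N j; eapply Rle_trans; [apply Hf|].
  rewrite <- (Rmult_1_r (M j)) at 2; apply Rmult_le_compat_l; [apply HM0|].
  rewrite <- (pow1 j); apply pow_incr, Hq1.
- apply (ex_series_scal (V := R_NormedModule) K), ex_series_theta; lra.
- intros [|j].
  + apply (is_CLim_ext (fun _ => 1)); [|apply is_CLim_const].
    intros N; unfold wterm; simpl; field.
  + apply is_CLim_squeeze with (fun N => (M (S j) * Cmod q ^ N)%R).
    * intros N; unfold Cminus; rewrite Copp_0, Cplus_0_r.
      eapply Rle_trans; [apply Hf|].
      apply Rmult_le_compat_l; [apply HM0|]; simpl.
      rewrite <- (Rmult_1_r (Cmod q ^ N)) at 3.
      apply Rmult_le_compat_l; [apply Hq1|].
      rewrite <- (pow1 j); apply pow_incr, Hq1.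
    * replace (Finite 0) with (Finite (M (S j) * 0)) by (f_equal; ring).
      apply is_lim_seq_mult'; [apply is_lim_seq_const|].
      apply is_lim_seq_geom; rewrite Rabs_pos_eq; lra.
- intros N; apply is_CSeries_wterm; auto;
    (eapply Rle_lt_trans; [apply Hle|assumption]).
- assert (H1 := is_CSeries_finite
    (fun j => match j with O => RtoC 1 | S _ => 0 end) 0).
  rewrite Csum_O in H1.
  rewrite (is_CLim_unique _ 1 l (H1 ltac:(intros [|k] Hk; [lia|reflexivity])) Hl).
  exact Hl'.
Qed.

(* The limit [d -> oo] of the nonterminating 6phi5 summation formula with
   parameters [q/a, q/b, d]. *)
Lemma wterm_sum (q alpha a b : C) :
  (0 < Cmod q)%R -> (Cmod q < 1)%R -> a <> 0 -> b <> 0 ->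
  (Cmod (alpha * a) < 1)%R -> (Cmod (alpha * b) < 1)%R ->
  is_CSeries (wterm q alpha a b)
    (qpoch_inf (alpha * q) q * qpoch_inf (alpha * a * b / q) q
     / (qpoch_inf (alpha * a) q * qpoch_inf (alpha * b) q)).
Proof.
intros Hq0 Hq Ha Hb Hx Hy.
set (s := CSeries (wterm q alpha a b)).
assert (Hs := is_CSeries_wterm q alpha a b Hq0 Hq Hx Hy); fold s in Hs.
(* The recurrence iterated [N] times, with denominators cleared. *)
assert (Hiter : forall N,
  qpoch (alpha * q) q N * qpoch (alpha * a * b / q) q N
    * CSeries (wterm q (alpha * q ^ N) a b)
  = qpoch (alpha * a) q N * qpoch (alpha * b) q N * s).
{ induction N as [|N IH].
  - simpl; rewrite (Cmult_1_r alpha); fold s; ring.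
  - assert (Hle : forall c, (Cmod (alpha * c) < 1)%R ->
                    (Cmod (alpha * q ^ N * c) < 1)%R).
    { intros c Hc; replace (alpha * q ^ N * c) with (alpha * c * q ^ N) by ring.
      eapply Rle_lt_trans; [now apply Cmod_mul_pow_le|exact Hc]. }
    assert (E := CSeries_wterm_rec q (alpha * q ^ N) a b Hq0 Hq Ha Hb
                   (Hle a Hx) (Hle b Hy)).
    replace (alpha * q ^ N * q) with (alpha * q ^ S N) in E
      by (rewrite Cpow_S; ring).
    simpl qpoch.
    set (s' := CSeries (wterm q (alpha * q ^ S N) a b)) in *.
    set (s0 := CSeries (wterm q (alpha * q ^ N) a b)) in *.
    clearbody s s' s0.
    transitivity (qpoch (alpha * q) q N * qpoch (alpha * a * b / q) q N
      * ((1 - alpha * q ^ S N) * (1 - alpha * q ^ N * a * b / q)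
         * s')).
    { rewrite Cpow_S; unfold Cdiv; ring. }
    rewrite <- E.
    transitivity ((1 - alpha * q ^ N * a) * (1 - alpha * q ^ N * b)
      * (qpoch (alpha * q) q N * qpoch (alpha * a * b / q) q N
         * s0)); [ring|].
    rewrite IH; ring. }
(* Limit of [Hiter]; the factor 1 is the limit of the shifted sum. *)
assert (E : qpoch_inf (alpha * q) q * qpoch_inf (alpha * a * b / q) q * 1
            = qpoch_inf (alpha * a) q * qpoch_inf (alpha * b) q * s).
{ apply (is_CLim_unique (fun N =>
    qpoch (alpha * q) q N * qpoch (alpha * a * b / q) q N
    * CSeries (wterm q (alpha * q ^ N) a b))).
  - apply is_CLim_mult; [apply is_CLim_mult; now apply qpoch_inf_correct|].
    now apply CSeries_wterm_shift_lim.
  - apply (is_CLim_ext (fun N => qpoch (alpha * a) q N * qpoch (alpha * b) q N * s));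
      [intros N; symmetry; apply Hiter|].
    apply is_CLim_mult; [apply is_CLim_mult; now apply qpoch_inf_correct|].
    apply is_CLim_const. }
rewrite Cmult_1_r in E; rewrite E.
replace (_ / _) with s; [exact Hs|].
assert (N1 := qpoch_inf_neq_0 _ q Hq Hx); assert (N2 := qpoch_inf_neq_0 _ q Hq Hy).
field; auto.
Qed.

(** * The double series *)

Lemma div_neq_0 (x y : C) : x <> 0 -> y <> 0 -> x / y <> 0.
Proof.
intros Hx Hy E; apply Hx.
replace x with (x / y * y) by (field; exact Hy); rewrite E; ring.
Qed.

Lemma qpoch_inf_split (x q : C) (n : nat) : (Cmod q < 1)%R ->
  qpoch_inf x q = qpoch x q n * qpoch_inf (x * q ^ n) q.
Proof.
intros Hq; apply (is_CLim_unique (fun N => qpoch x q (n + N))).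
- apply (filterlim_comp _ _ _ (fun N => (n + N)%nat) (qpoch x q)
           eventually eventually); [|exact (qpoch_inf_correct x q Hq)].
  intros P [N0 HN0]; exists N0; intros N HN; apply HN0; lia.
- apply (is_CLim_ext (fun N => qpoch x q n * qpoch (x * q ^ n) q N)).
  + intros N; now rewrite qpoch_add.
  + apply is_CLim_mult; [apply is_CLim_const|now apply qpoch_inf_correct].
Qed.

(** The factor of index [n] is [1 - q^(-n) q^n = 0]. *)
Lemma qpoch_inv_pow_vanish (q : C) (n k : nat) :
  q <> 0 -> (n < k)%nat -> qpoch (/ q ^ n) q k = 0.
Proof.
intros Hq Hk; replace k with (S n + (k - S n))%nat by lia.
rewrite qpoch_add; simpl; rewrite Cinv_l by now apply Cpow_nz.
ring.
Qed.

(** With [n = k + j], taking [- q^(i-n)] out of each factor [1 - q^(i-n)] reverses the product into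
    [(q;q)_n / (q;q)_j]; the extracted powers give [q^(k(k-1)/2 - k n)]. *)
Lemma qpoch_inv_pow (q : C) (k j : nat) : q <> 0 ->
  qpoch (/ q ^ (k + j)) q k * qpoch q q j * q ^ (k * (k + j))
  = (-1) ^ k * q ^ (k * (k - 1) / 2) * qpoch q q (k + j).
Proof.
intros Hq; induction k as [|k IH]; [simpl; ring|].
(* Removing the first factor multiplies the argument [q^(-(k+1+j))] by [q], which is the argument in
   the induction hypothesis for the same [j]. *)
rewrite qpoch_S_l, tri_S.
replace (S k * (S k + j))%nat with (k * (k + j) + (k + (S k + j)))%nat by lia.
rewrite !Cpow_add_r, (Cpow_S (-1) k).
replace (S k + j)%nat with (S (k + j)) by lia.
change (qpoch q q (S (k + j))) with (qpoch q q (k + j) * (1 - q * q ^ (k + j))).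
rewrite Cpow_add_r in IH |- *.
replace (/ (q ^ S k * q ^ j) * q) with (/ (q ^ k * q ^ j))
  by (rewrite Cpow_S; field; repeat split; auto using Cpow_nz).
transitivity (- (q ^ k * (1 - q * (q ^ k * q ^ j)))
  * (qpoch (/ (q ^ k * q ^ j)) q k * qpoch q q j * q ^ (k * (k + j)))).
- rewrite Cpow_S; field; repeat split; auto using Cpow_nz.
- rewrite IH; ring.
Qed.

(** * Products over parameter vectors and terms of the basic hypergeometric series *)

Lemma qpochs_cons {m : nat} (x : C) (xs : Vector.t C m) (q : C) (n : nat) :
  qpochs (x :: xs)%vector q n = qpoch x q n * qpochs xs q n.
Proof. reflexivity. Qed.

Lemma qpochs_bound {m : nat} (xs : Vector.t C m) (q : C) : (Cmod q < 1)%R ->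
  exists K, (0 < K)%R /\ forall n, (Cmod (qpochs xs q n) <= K)%R.
Proof.
intros Hq; induction xs as [|x m xs [K [HK IH]]].
- exists 1%R; split; [lra|]; intros n; change (Cmod 1 <= 1)%R; rewrite Cmod_1; lra.
- destruct (qpoch_uniform_bound q (Cmod x) Hq) as [K' [HK' H]].
  exists (K' * K)%R; split; [now apply Rmult_lt_0_compat|].
  intros n; rewrite qpochs_cons, Cmod_mult.
  apply Rmult_le_compat; try apply Cmod_ge_0; [apply H, Rle_refl|apply IH].
Qed.

Lemma qpochs_neq_0 {m : nat} (xs : Vector.t C m) (q : C) (n : nat) :
  (Cmod q < 1)%R -> Vector.Forall (fun x => (Cmod x < 1)%R) xs ->
  qpochs xs q n <> 0.
Proof.
intros Hq H; induction H as [|m x xs Hx H IH].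
- exact C1_nz.
- rewrite qpochs_cons; apply Cmult_neq_0; [now apply qpoch_neq_0|exact IH].
Qed.

Lemma qpochs_inv_bound {m : nat} (xs : Vector.t C m) (q : C) :
  (Cmod q < 1)%R -> Vector.Forall (fun x => (Cmod x < 1)%R) xs ->
  exists K, (0 < K)%R /\ forall n, (Cmod (/ qpochs xs q n) <= K)%R.
Proof.
intros Hq HF; induction HF as [|m x xs Hx HF [K [HK IH]]].
- exists 1%R; split; [lra|]; intros n; change (Cmod (/ RtoC 1) <= 1)%R.
  rewrite Cmod_inv, Cmod_1 by exact C1_nz; lra.
- destruct (qpoch_inv_bound q (Cmod x) Hq Hx) as [K' [HK' H]].
  exists (K' * K)%R; split; [now apply Rmult_lt_0_compat|].
  intros n; rewrite qpochs_cons.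
  replace (/ (qpoch x q n * qpochs xs q n))
    with (/ qpoch x q n * / qpochs xs q n)
    by (field; split; [now apply qpochs_neq_0|now apply qpoch_neq_0]).
  rewrite Cmod_mult.
  apply Rmult_le_compat; try apply Cmod_ge_0; [apply H, Rle_refl|apply IH].
Qed.

Lemma Forall_map_lt {m : nat} (alpha : C) (cs : Vector.t C m) :
  Vector.Forall (fun c => (Cmod (alpha * c) < 1)%R) cs ->
  Vector.Forall (fun x => (Cmod x < 1)%R)
    (Vector.map (fun x => alpha * x) cs).
Proof. intros H; induction H; simpl; constructor; assumption. Qed.

Lemma phi_term_bound {r : nat} (A : Vector.t C (S r)) (B : Vector.t C r)
    (q z : C) :
  (Cmod q < 1)%R -> Vector.Forall (fun x => (Cmod x < 1)%R) B ->
  exists K, (0 < K)%R /\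
    forall n, (Cmod (phi_term A B q z n) <= K * Cmod z ^ n)%R.
Proof.
intros Hq HB.
destruct (qpochs_bound A q Hq) as [K1 [HK1 H1]].
destruct (qpochs_inv_bound (q :: B)%vector q Hq) as [K2 [HK2 H2]];
  [now constructor|].
exists (K1 * K2)%R; split; [now apply Rmult_lt_0_compat|].
intros n; unfold phi_term, Cdiv; rewrite 2!Cmod_mult, Cmod_pow.
apply Rmult_le_compat_r; [apply pow_le, Cmod_ge_0|].
apply Rmult_le_compat; try apply Cmod_ge_0; auto.
Qed.

Lemma phi_term_terminating {r : nat} (A : Vector.t C r) (B : Vector.t C r)
    (q z : C) (n : nat) : q <> 0 ->
  is_CSeries (phi_term (/ q ^ n :: A)%vector B q z)
    (Csum (phi_term (/ q ^ n :: A)%vector B q z) n).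
Proof.
intros Hq; apply is_CSeries_finite; intros k Hk.
unfold phi_term; rewrite qpochs_cons, qpoch_inv_pow_vanish by assumption.
unfold Cdiv; ring.
Qed.

Lemma shifted_product (q alpha a : C) (k : nat) : q <> 0 ->
  alpha * q ^ (2 * k) * (a / q ^ k) = alpha * a * q ^ k.
Proof.
intros Hq; replace (2 * k)%nat with (k + k)%nat by lia; rewrite Cpow_add_r.
field; now apply Cpow_nz.
Qed.

(** Term [k] of the inner series inside the outer term [n = k + j], stored in regrouped form: [j]
    occurs only in [wterm], so each row is summed by [wterm_sum]. *)
Definition double_term {m : nat} (q alpha a b z : C) (bs cs : Vector.t C m)
    (k j : nat) : C :=
  phi_term (q / a :: q / b :: bs)%vector (RtoC 0 :: cs)%vector q
    (alpha * a * b * z / q) k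
  * (qpoch (alpha * q) q (2 * k)
     / (qpoch (alpha * a) q k * qpoch (alpha * b) q k))
  * wterm q (alpha * q ^ (2 * k)) (a / q ^ k) (b / q ^ k) j.

(** [vwp_mul_qpoch] absorbs [(alpha q^n;q)_k], [qpoch_inv_pow] turns [(q^(-n);q)_k / (q;q)_n] into
    [1 / (q;q)_j] up to sign and powers of [q], and the other symbols of length [n] split at [k].
    The remaining power of [q] is [q^(j(j-1)/2)]. *)
Lemma double_term_correct {m : nat} (q alpha a b z : C) (bs cs : Vector.t C m)
    (k j : nat) :
  (0 < Cmod q)%R -> (Cmod q < 1)%R -> a <> 0 -> b <> 0 -> alpha <> 1 ->
  (Cmod (alpha * a) < 1)%R -> (Cmod (alpha * b) < 1)%R ->
  Vector.Forall (fun c => (Cmod c < 1)%R) cs ->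
  let n := (k + j)%nat in
  (1 - alpha * q ^ (2 * n)) * qpochs [alpha; q / a; q / b]%vector q n
      * (- (alpha * a * b / q)) ^ n * q ^ (n * (n - 1) / 2)
      / ((1 - alpha) * qpochs [q; alpha * a; alpha * b]%vector q n)
    * phi_term (/ q ^ n :: alpha * q ^ n :: bs)%vector (RtoC 0 :: cs)%vector
        q (z * q) k
  = double_term q alpha a b z bs cs k j.
Proof.
intros Hq0 Hq Ha Hb Hal Hx Hy Hcs n.
assert (Nq : q <> 0) by now apply Cmod_gt_0.
assert (N1 : 1 - alpha <> 0).
{ intros E; apply Hal; rewrite <- (Cplus_0_r alpha), <- E; ring. }
unfold double_term, phi_term, wterm; rewrite !qpochs_cons.
change (qpochs (Vector.nil C) q n) with (RtoC 1).
rewrite !qpoch_0_l.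
replace (q / (a / q ^ k)) with (q / a * q ^ k)
  by (field; split; auto using Cpow_nz).
replace (q / (b / q ^ k)) with (q / b * q ^ k)
  by (field; split; auto using Cpow_nz).
rewrite 2!shifted_product by assumption.
replace (alpha * a * q ^ k * (b / q ^ k) / q) with (alpha * a * b / q)
  by (field; split; auto using Cpow_nz).
replace (alpha * a * b * z / q) with (alpha * a * b / q * z)
  by (unfold Cdiv; ring).
assert (E1 := vwp_correct alpha q n).
assert (E2 := vwp_mul_qpoch alpha q k j); fold n in E2.
assert (E3 := qpoch_inv_pow q k j Nq); fold n in E3.
(* [k n = 2 (k(k-1)/2) + k + k j], matched to the exponents in [E4]; the halved product is evaluated
   through [tri_add k k]. *)
replace (k * n)%nat
  with (k * (k - 1) / 2 + k * (k - 1) / 2 + k + k * j)%nat in E3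
  by (assert (T := tri_add k k);
      assert (T' := Nat.div_mul (k * (2 * k - 1)) 2 ltac:(lia));
      replace ((k + k) * (k + k - 1))%nat with (k * (2 * k - 1) * 2)%nat in T
        by nia;
      unfold n; nia).
rewrite !Cpow_add_r in E3.
assert (E4 : q ^ (n * (n - 1) / 2) = q ^ (k * (k - 1) / 2)
               * q ^ (j * (j - 1) / 2) * q ^ (k * j))
  by (unfold n; now rewrite tri_add, !Cpow_add_r).
set (y := alpha * a * b / q).
assert (E5 : (- y) ^ n = (-1) ^ k * y ^ k * (- y) ^ j).
{ unfold n; rewrite Cpow_add_r, <- Cpow_mult_l.
  now replace (-1 * y) with (- y) by ring. }
rewrite E4, E5, !Cpow_mult_l.
rewrite (Cmult_assoc (1 - alpha * _)), E1.
assert (Hsplit : forall x, qpoch x q n = qpoch x q k * qpoch (x * q ^ k) q j)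
  by (intros x; apply qpoch_add).
assert (Hnz : forall x i, (Cmod x < 1)%R -> qpoch x q i <> 0)
  by (intros x i; now apply qpoch_neq_0).
assert (Hlt : forall x, (Cmod x < 1)%R -> (Cmod (x * q ^ k) < 1)%R)
  by (intros x H; eapply Rle_lt_trans; [now apply Cmod_mul_pow_le|exact H]).
assert (M1 := Hnz q n Hq); assert (M2 := Hnz q k Hq).
assert (M3 := Hnz q j Hq).
assert (M4 := Hnz _ k Hx); assert (M5 := Hnz _ j (Hlt _ Hx)).
assert (M6 := Hnz _ k Hy); assert (M7 := Hnz _ j (Hlt _ Hy)).
assert (M8 := qpochs_neq_0 cs q k Hq Hcs).
rewrite (Hsplit (q / a)), (Hsplit (q / b)), (Hsplit (alpha * a)),
  (Hsplit (alpha * b)).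
(* One sign comes from [(- y) ^ n] in [E5], the other from the reversal in [E3]. *)
assert (Hsgn : (-1) ^ k * (-1) ^ k = 1).
{ rewrite <- Cpow_mult_l; replace (-1 * -1) with (RtoC 1) by ring.
  apply Cpow_1_l. }
assert (P1 := Cpow_nz q (k * (k - 1) / 2) Nq).
assert (P2 := Cpow_nz q k Nq); assert (P3 := Cpow_nz q (k * j) Nq).
set (t := q ^ (k * (k - 1) / 2)) in *.
set (tj := q ^ (j * (j - 1) / 2)) in *.
set (x := q ^ k) in *; set (xj := q ^ (k * j)) in *.
set (sg := (-1) ^ k) in *.
set (V := vwp alpha q n) in *.
set (V' := vwp (alpha * q ^ (2 * k)) q j) in *.
set (R1 := qpoch (alpha * q ^ n) q k) in *.
set (R2 := qpoch (/ q ^ n) q k) in *.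
set (R3 := qpoch (alpha * q) q (2 * k)) in *.
set (yk := y ^ k); set (yj := (- y) ^ j); set (zk := z ^ k).
set (Qn := qpoch q q n) in *; set (Qk := qpoch q q k) in *.
set (Qj := qpoch q q j) in *.
set (D1 := qpoch (alpha * a) q k) in *.
set (D2 := qpoch (alpha * a * x) q j) in *.
set (D3 := qpoch (alpha * b) q k) in *.
set (D4 := qpoch (alpha * b * x) q j) in *.
set (U1 := qpoch (q / a) q k); set (U2 := qpoch (q / a * x) q j).
set (U3 := qpoch (q / b) q k); set (U4 := qpoch (q / b * x) q j).
set (Bk := qpochs bs q k); set (Ck := qpochs cs q k) in *.
clearbody t tj x xj sg V V' R1 R2 R3 yk yj zk Qn Qk Qj D1 D2 D3 D4
  U1 U2 U3 U4 Bk Ck.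
clear E1 E4 E5 Hsplit Hnz Hlt.
(* The first two groups are the left-hand sides of [E2] and [E3]. *)
transitivity ((V * R1) * (R2 * Qj * (t * t * x * xj)) * sg
  * (U1 * U2 * (U3 * U4) * yk * yj * tj * Bk * zk
     / (Qn * D1 * D2 * D3 * D4 * Qk * Ck * Qj * t))).
{ field; repeat split; assumption. }
rewrite E2, E3.
transitivity (sg * sg * (R3 * V'
  * (U1 * U2 * (U3 * U4) * yk * yj * tj * Bk * zk
     / (D1 * D2 * D3 * D4 * Qk * Ck * Qj)))).
{ field; repeat split; assumption. }
rewrite Hsgn; field; repeat split; assumption.
Qed.

(** The shift by [k] leaves [alpha a b / q] unchanged and does not increase the moduli of the other
    parameters in [wterm_bound], so the majorant factors into a function of [k] and one of [j], as
    [is_CSeries_diagonal] requires. *)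
Lemma double_term_bound {m : nat} (q alpha a b z : C) (bs cs : Vector.t C m) :
  (0 < Cmod q)%R -> (Cmod q < 1)%R -> a <> 0 -> b <> 0 ->
  (Cmod (alpha * a) < 1)%R -> (Cmod (alpha * b) < 1)%R ->
  Vector.Forall (fun c => (Cmod c < 1)%R) cs ->
  exists K L, (0 < K)%R /\ (0 < L)%R /\ forall k j,
    (Cmod (double_term q alpha a b z bs cs k j)
     <= K * Cmod (alpha * a * b * z / q) ^ k
        * (L * (Cmod (alpha * a * b / q) ^ j * Cmod q ^ (j * (j - 1) / 2))))%R.
Proof.
intros Hq0 Hq Ha Hb Hx Hy Hcs.
assert (Nq : q <> 0) by now apply Cmod_gt_0.
destruct (phi_term_bound (q / a :: q / b :: bs)%vector (RtoC 0 :: cs)%vector q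
            (alpha * a * b * z / q) Hq) as [K1 [HK1 H1]].
{ constructor; [rewrite Cmod_0; lra|exact Hcs]. }
destruct (qpoch_uniform_bound q (Cmod (alpha * q)) Hq) as [K2 [HK2 H2]].
destruct (qpoch_inv_bound q (Cmod (alpha * a)) Hq Hx) as [K3 [HK3 H3]].
destruct (qpoch_inv_bound q (Cmod (alpha * b)) Hq Hy) as [K4 [HK4 H4]].
destruct (wterm_bound q (Cmod alpha) (Rmax (Cmod (q / a)) (Cmod (q / b)))
            (Rmax (Cmod (alpha * a)) (Cmod (alpha * b))) Hq)
  as [L [HL HLb]]; [now apply Rmax_lub_lt|].
exists (K1 * (K2 * (K3 * K4)))%R, L; split; [|split; [assumption|]].
{ repeat apply Rmult_lt_0_compat; assumption. }
intros k j; unfold double_term; rewrite Cmod_mult.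
apply Rmult_le_compat; try apply Cmod_ge_0.
- rewrite Cmod_mult.
  replace (K1 * (K2 * (K3 * K4)) * Cmod (alpha * a * b * z / q) ^ k)%R
    with (K1 * Cmod (alpha * a * b * z / q) ^ k * (K2 * (K3 * K4)))%R by ring.
  apply Rmult_le_compat; try apply Cmod_ge_0; [apply H1|].
  replace (qpoch (alpha * q) q (2 * k)
            / (qpoch (alpha * a) q k * qpoch (alpha * b) q k))
    with (qpoch (alpha * q) q (2 * k)
            * (/ qpoch (alpha * a) q k * / qpoch (alpha * b) q k))
    by (field; split; now apply qpoch_neq_0).
  rewrite 2!Cmod_mult.
  repeat apply Rmult_le_compat; try apply Rmult_le_pos; try apply Cmod_ge_0;
    [apply H2|apply H3|apply H4]; apply Rle_refl.
- eapply Rle_trans; [apply HLb|].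
  + now apply Cmod_mul_pow_le.
  + replace (q / (a / q ^ k)) with (q / a * q ^ k)
      by (field; split; auto using Cpow_nz).
    eapply Rle_trans; [now apply Cmod_mul_pow_le|apply Rmax_l].
  + replace (q / (b / q ^ k)) with (q / b * q ^ k)
      by (field; split; auto using Cpow_nz).
    eapply Rle_trans; [now apply Cmod_mul_pow_le|apply Rmax_r].
  + rewrite shifted_product by assumption.
    eapply Rle_trans; [now apply Cmod_mul_pow_le|apply Rmax_l].
  + rewrite shifted_product by assumption.
    eapply Rle_trans; [now apply Cmod_mul_pow_le|apply Rmax_r].
  + rewrite shifted_product by assumption.
    replace (alpha * a * q ^ k * (b / q ^ k) / q) with (alpha * a * b / q)
      by (field; split; auto using Cpow_nz).
    apply Rle_refl.
Qed.

(** [wterm_sum] at the shifted parameters gives infinite products starting at [q^(2k)] or [q^k]; the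
    finite quotient in [double_term] supplies exactly the missing initial factors, so the total
    product does not depend on [k]. *)
Lemma is_CSeries_double_term {m : nat} (q alpha a b z : C)
    (bs cs : Vector.t C m) (k : nat) :
  (0 < Cmod q)%R -> (Cmod q < 1)%R -> a <> 0 -> b <> 0 ->
  (Cmod (alpha * a) < 1)%R -> (Cmod (alpha * b) < 1)%R ->
  is_CSeries (double_term q alpha a b z bs cs k)
    (qpoch_inf (alpha * q) q * qpoch_inf (alpha * a * b / q) q
       / (qpoch_inf (alpha * a) q * qpoch_inf (alpha * b) q)
     * phi_term (q / a :: q / b :: bs)%vector (RtoC 0 :: cs)%vector q
         (alpha * a * b * z / q) k).
Proof.
intros Hq0 Hq Ha Hb Hx Hy.
assert (Nq : q <> 0) by now apply Cmod_gt_0.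
assert (Nk := Cpow_nz q k Nq).
assert (Hlt : forall x, (Cmod x < 1)%R -> (Cmod (x * q ^ k) < 1)%R)
  by (intros x H; eapply Rle_lt_trans; [now apply Cmod_mul_pow_le|exact H]).
assert (H := wterm_sum q (alpha * q ^ (2 * k)) (a / q ^ k) (b / q ^ k) Hq0 Hq).
rewrite 2!shifted_product in H by assumption.
replace (alpha * a * q ^ k * (b / q ^ k) / q) with (alpha * a * b / q) in H
  by (field; split; auto).
replace (alpha * q ^ (2 * k) * q) with (alpha * q * q ^ (2 * k)) in H by ring.
specialize (H (div_neq_0 _ _ Ha Nk)
              (div_neq_0 _ _ Hb Nk)
              (Hlt _ Hx) (Hlt _ Hy)).
rewrite (qpoch_inf_split (alpha * q) q (2 * k) Hq).
rewrite (qpoch_inf_split (alpha * a) q k Hq).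
rewrite (qpoch_inf_split (alpha * b) q k Hq).
assert (M1 := qpoch_neq_0 _ q k Hq Hx); assert (M2 := qpoch_neq_0 _ q k Hq Hy).
assert (M3 := qpoch_inf_neq_0 _ q Hq (Hlt _ Hx)).
assert (M4 := qpoch_inf_neq_0 _ q Hq (Hlt _ Hy)).
match type of H with is_CSeries _ ?s =>
  replace (_ * phi_term _ _ _ _ _) with
    (phi_term (q / a :: q / b :: bs)%vector (RtoC 0 :: cs)%vector q
       (alpha * a * b * z / q) k
     * (qpoch (alpha * q) q (2 * k)
        / (qpoch (alpha * a) q k * qpoch (alpha * b) q k)) * s)
    by (field; auto)
end.
exact (is_CSeries_scal _ _ _ H).
Qed.

Theorem theorem1p2 (q : C) (m : nat) (alpha a b z : C) (bs cs : Vector.t C m)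
    (hq0 : (0 < Cmod q)%R) (hq1 : (Cmod q < 1)%R)
    (ha : a <> 0) (hb : b <> 0) (halpha : alpha <> 1)
    (hz : (Cmod (alpha * a * b * z / q) < 1)%R)
    (hala : (Cmod (alpha * a) < 1)%R)
    (halb : (Cmod (alpha * b) < 1)%R)
    (halc : Vector.Forall (fun c => (Cmod (alpha * c) < 1)%R) cs) :
  let albs := Vector.map (fun x => alpha * x) bs in
  let alcs := Vector.map (fun x => alpha * x) cs in
  let lhsA := (q / a :: q / b :: albs)%vector in
  let rhsA n := (/ q ^ n :: alpha * q ^ n :: albs)%vector in
  let B := (RtoC 0 :: alcs)%vector in
  let rhs_term n :=
    (1 - alpha * q ^ (2 * n)) * qpochs [alpha; q / a; q / b]%vector q n
      * (- (alpha * a * b / q)) ^ n * q ^ (n * (n - 1) / 2)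
      / ((1 - alpha) * qpochs [q; alpha * a; alpha * b]%vector q n)
      * phi (rhsA n) B q (z * q) in
  ex_CSeries (phi_term lhsA B q (alpha * a * b * z / q)) /\
  (forall n : nat, ex_CSeries (phi_term (rhsA n) B q (z * q))) /\
  ex_CSeries rhs_term /\
  qpochs_inf [alpha * q; alpha * a * b / q]%vector q
    / qpochs_inf [alpha * a; alpha * b]%vector q
    * phi lhsA B q (alpha * a * b * z / q)
  = CSeries rhs_term.
Proof.
intros albs alcs lhsA rhsA B rhs_term.
assert (Nq : q <> 0) by now apply Cmod_gt_0.
assert (Halcs : Vector.Forall (fun c => (Cmod c < 1)%R) alcs)
  by now apply Forall_map_lt.
assert (Hrhs : forall n, is_CSeries (phi_term (rhsA n) B q (z * q))
                           (Csum (phi_term (rhsA n) B q (z * q)) n))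
  by (intros n; now apply phi_term_terminating).
assert (Hgeom : ex_series (fun k => (Cmod (alpha * a * b * z / q) ^ k)%R)).
{ apply ex_series_geom; now rewrite Rabs_pos_eq by apply Cmod_ge_0. }
destruct (phi_term_bound lhsA B q (alpha * a * b * z / q) hq1) as [K0 [_ H0]].
{ constructor; [rewrite Cmod_0; lra|exact Halcs]. }
destruct (ex_CSeries_le _ _ H0) as [s Hs].
{ apply (ex_series_scal (V := R_NormedModule) K0), Hgeom. }
destruct (double_term_bound q alpha a b z albs alcs hq0 hq1 ha hb hala halb
            Halcs) as [K [L [HK [HL HKL]]]].
(* [l] is the sum of the double series both by rows and by antidiagonals. *)
destruct (is_CSeries_diagonal _
  (fun k => (K * Cmod (alpha * a * b * z / q) ^ k)%R)
  (fun j => (L * (Cmod (alpha * a * b / q) ^ j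
                  * Cmod q ^ (j * (j - 1) / 2)))%R) _ HKL
  (fun k => is_CSeries_double_term q alpha a b z albs alcs k
              hq0 hq1 ha hb hala halb)) as [l [Hl Hl']].
{ intros k; apply Rmult_le_pos; [lra|apply pow_le, Cmod_ge_0]. }
{ intros j; repeat apply Rmult_le_pos; try apply pow_le; try apply Cmod_ge_0;
    lra. }
{ apply (ex_series_scal (V := R_NormedModule) K), Hgeom. }
{ apply (ex_series_scal (V := R_NormedModule) L), ex_series_theta;
    [apply Cmod_ge_0|lra]. }
assert (Hrhs' : is_CSeries rhs_term l).
(* The antidiagonal [n] of the double series is the outer term [n] with its inner series cut at [n],
   where it terminates. *)
{ apply (is_CSeries_ext (fun n =>
    Csum (fun k => double_term q alpha a b z albs alcs k (n - k)) n));
    [|exact Hl'].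
  intros n; unfold rhs_term, phi.
  rewrite (CSeries_unique _ _ (Hrhs n)), <- Csum_scal.
  apply Csum_ext; intros k Hk.
  rewrite <- double_term_correct by assumption.
  now replace (k + (n - k))%nat with n by lia. }
split; [now exists s|].
split; [intros n; eexists; apply Hrhs|].
split; [now exists l|].
rewrite (CSeries_unique _ _ Hrhs').
unfold phi; rewrite (CSeries_unique _ _ Hs).
unfold qpochs_inf; cbn [Vector.fold_right]; rewrite !Cmult_1_r.
(* The row sums have sum [l], and they are also a constant multiple of the left-hand series. *)
exact (is_CLim_unique _ _ _ (is_CSeries_scal _ _ _ Hs) Hl).
Qed.
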